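(* For integers $m,p\geq 0$, with $w:=m+p+2$ and $|k|_l:=k_1+\cdots+k_l$, \[ \sum_{n=1}^\infty\frac{\zeta_n^\star(\{1\}_m)\binom{2n}{n}}{4^n n}=-2^{m+1}\zeta(\overline{m+1})\,, \] and \[ \sum_{n=1}^\infty\frac{\zeta_n^\star(\{1\}_m)\binom{2n}{n}}{4^n n^{p+2}} =-2^{m+1}\sum_{\substack{|k|_{p+1}\leq w-1\\k_1,\ldots,k_{p+1}\geq 1}} \zeta\left(\bar{k}_{p+1},\widehat{w-|k|_{p+1}},\hat{k}_1,\hat k_2,\ldots,\hat k_p\right)\,, \] the last sum being over integers $k_1,\dots,k_{p+1}\geq 1$.
   Context: $\zeta_n^\star(\{1\}_m):=\sum_{n\geq n_1\geq n_2\geq\cdots\geq n_m\geq 1}\frac{1}{n_1n_2\cdots n_m}$, with $\zeta_n^\star(\emptyset)=1$; $\{a\}_m$ denotes $m$ repetitions of $a$. $\zeta(\overline{s})=\sum_{n\ge1}(-1)^n n^{-s}$. Mixed multiple zeta values: for positive integers $s_1,\dots,s_r$, each possibly decorated by a bar, hat or tilde, $\zeta(s_1,\dots,s_r):=\sum_{n_1>n_2>\cdots>n_r\geq 1}\prod_{j=1}^r \frac{\epsilon_j(n_j)}{n_j^{s_j}}$, where $\epsilon_j(n)=1$ for undecorated $s_j$, $(-1)^n$ for $\bar s_j$, $1+(-1)^n$ for $\hat s_j$, and $1-(-1)^n$ for $\tilde s_j$. *)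

(* Defs.v *)
From HB Require Import structures.
From mathcomp Require Import all_boot all_order all_algebra.
From mathcomp Require Import all_classical all_reals all_analysis.
Import Order.TTheory GRing.Theory Num.Theory numFieldNormedType.Exports.

Set Implicit Arguments.
Unset Strict Implicit.
Unset Printing Implicit Defensive.

Local Open Scope ring_scope.
Local Open Scope classical_set_scope.

Definition zeta_star_ones (R : realType) (n m : nat) : R :=
  \sum_(t : m.-tuple 'I_n.+1 |
          sorted geq (map val t) && all (leq 1) (map val t))
    \prod_(i <- t) (i%:R)^-1.

Inductive decoration := Plain | Bar | Hat | Tilde.

Definition eps (R : realType) (d : decoration) (n : nat) : R :=
  match d with
  | Plain => 1
  | Bar => (-1) ^+ n
  | Hat => 1 + (-1) ^+ n
  | Tilde => 1 - (-1) ^+ n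
  end.

(* An argument list pairs each exponent s_j with its decoration; the outermost
   summation index n_1 belongs to the head of the list. *)
Definition mmzv_partial (R : realType) (s : seq (nat * decoration)) (N : nat)
    : R :=
  \sum_(t : (size s).-tuple 'I_N.+1 |
          sorted gtn (map val t) && all (leq 1) (map val t))
    \prod_(j < size s)
       (eps R (tnth (in_tuple s) j).2 (tnth t j)
          / (tnth t j)%:R ^+ (tnth (in_tuple s) j).1).

(* When the leading argument is Bar 1 the series converges only conditionally,
   so the multiple series is the limit of its truncations n_1 <= N. *)
Definition mmzv (R : realType) (s : seq (nat * decoration)) : R :=
  limn (mmzv_partial R s).

(* For k = (k_1, ..., k_{p+1}):
   (bar k_{p+1}, hat (w - |k|), hat k_1, ..., hat k_p). *)
Definition rhs_args (p w : nat) (k : p.+1.-tuple 'I_w)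
    : seq (nat * decoration) :=
  let ks := map val k in
  [:: (last 0%N ks, Bar), ((w - sumn ks)%N, Hat)
    & [seq (x, Hat) | x <- take p ks]].

(* The components are positive with sum at most w - 1, so bounding each of
   them by w in the type loses nothing. *)
Definition admissible (p w : nat) (k : p.+1.-tuple 'I_w) : bool :=
  all (leq 1) (map val k) && (sumn (map val k) <= w - 1)%N.

(* Main.v *)
(* With [X] marking [m], zeta*_n({1}_m) is the coefficient of [X ^ m] in
   [n! / ((1 - X) ... (n - X))].  Put, for [k >= 0] and [q >= 0],
     [F_q(k) = sum_(n >= 1) (1/2)_n / ((k + 1 - X)_n n ^ (q + 1))].
   As [1/(b)_n - 1/(b+1)_n = n / (b)_(n+1)], one has
   [F_(q+1)(k) - F_(q+1)(k+1) = F_q(k+1) / (k + 1 - X)], while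
   [F_0(k) - F_0(k+1)] telescopes to [1/(k + 1/2 - X) - 1/(k + 1 - X)].
   Iterating in [k] writes [F_q(0)] as the sum over [k] of this difference times
   the elementary symmetric function of degree [q] in the [1/(l - X)], [l <= k];
   the two terms of the difference are the summands [n = 2k + 1] and [n = 2k + 2]
   of the outermost (barred) index, and the factors [1/(l - X)] are the hatted
   indices [2l].  The rearrangement is made on truncated sums, whose remainder is
   bounded coefficientwise by comparison with [X = 1/4]. *)
Require Import Defs.
From HB Require Import structures.
From mathcomp Require Import all_boot all_order all_algebra.
From mathcomp Require Import all_classical all_reals all_analysis.
From mathcomp Require Import ring lra zify.
Import Order.TTheory GRing.Theory Num.Theory numFieldNormedType.Exports.

Set Implicit Arguments.
Unset Strict Implicit.
Unset Printing Implicit Defensive.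

Local Open Scope ring_scope.
Local Open Scope classical_set_scope.

(* An alias, since [nat -> R] already carries the pointwise product. *)
Definition fps (R : comNzRingType) := nat -> R.

HB.instance Definition _ (R : comNzRingType) :=
  GRing.Zmodule.copy (fps R) (nat -> R).

(** * The ring of formal power series *)

Section FormalPowerSeries.
Variable R : comNzRingType.
Implicit Types (f g h : fps R) (c : R) (i n : nat).

Definition fps_one : fps R := fun i => (i == 0%N)%:R.

Definition fps_mul f g : fps R := fun i => \sum_(j < i.+1) f j * g (i - j)%N.

(** Coefficients of degree below [n] see only truncations, so associativity and commutativity are
    inherited from polynomials. *)
Lemma fps_mul_poly f g n i : (i < n)%N ->
  fps_mul f g i = (\poly_(j < n) f j * \poly_(j < n) g j)`_i.
Proof.
move=> lt_in; rewrite coefM; apply: eq_bigr => j _.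
have le_ji : (j <= i)%N by rewrite -ltnS.
by rewrite !coef_poly (leq_ltn_trans le_ji lt_in) (leq_ltn_trans (leq_subr _ _) lt_in).
Qed.

Lemma fps_mulA : associative fps_mul.
Proof.
move=> f g h; apply/funext => i.
pose T (k : fps R) := \poly_(j < i.+1) k j.
transitivity ((T f * T g * T h)`_i); last first.
  rewrite coefM; apply: eq_bigr => j _.
  by rewrite -fps_mul_poly // coef_poly ltnS leq_subr.
rewrite -mulrA coefM; apply: eq_bigr => j _.
by rewrite coef_poly ltn_ord -fps_mul_poly // ltnS leq_subr.
Qed.

Lemma fps_mulC : commutative fps_mul.
Proof.
by move=> f g; apply/funext => i; rewrite !(@fps_mul_poly _ _ i.+1) // mulrC.
Qed.

Lemma fps_mul1 : left_id fps_one fps_mul.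
Proof.
move=> f; apply/funext => i; rewrite /fps_mul big_ord_recl /= mul1r subn0.
by rewrite big1 ?addr0 // => j _; rewrite /fps_one /= mul0r.
Qed.

Lemma fps_mulDl : left_distributive fps_mul +%R.
Proof.
move=> f g h; apply/funext => i.
transitivity (\sum_(j < i.+1) (f j * h (i - j)%N + g j * h (i - j)%N)).
  by apply: eq_bigr => j _; rewrite -mulrDl.
by rewrite big_split.
Qed.

Lemma fps_one_neq0 : fps_one != 0 :> fps R.
Proof. by apply/eqP => /(congr1 (fun f => f 0%N)) /eqP; rewrite oner_eq0. Qed.

HB.instance Definition _ := GRing.Zmodule_isComNzRing.Build (fps R)
  fps_mulA fps_mulC fps_mul1 fps_mulDl fps_one_neq0.

Lemma coef_fpsM f g i : (f * g) i = \sum_(j < i.+1) f j * g (i - j)%N.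
Proof. by []. Qed.

Lemma coef_fpsD f g i : (f + g) i = f i + g i.
Proof. by []. Qed.

Lemma coef_fpsB f g i : (f - g) i = f i - g i.
Proof. by []. Qed.

Lemma coef_fps1 i : (1 : fps R) i = (i == 0%N)%:R.
Proof. by []. Qed.

Lemma coef_fps_sum I (r : seq I) (P : pred I) (F : I -> fps R) i :
  (\sum_(k <- r | P k) F k) i = \sum_(k <- r | P k) F k i.
Proof. by elim/big_rec2: _ => [//|k x y _ <-]. Qed.

Definition fpsC c : fps R := fun i => if i == 0%N then c else 0.

Lemma coef_fpsCM c f i : (fpsC c * f) i = c * f i.
Proof.
rewrite coef_fpsM big_ord_recl subn0 /= big1 ?addr0 // => j _.
by rewrite /fpsC /= mul0r.
Qed.

Lemma fpsC_is_zmod_morphism : zmod_morphism fpsC.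
Proof.
move=> a b; apply/funext => -[|i]; first by [].
by rewrite coef_fpsB /= subr0.
Qed.

Lemma fpsC_is_monoid_morphism : monoid_morphism fpsC.
Proof.
split; first by apply/funext => -[|i].
by move=> a b; apply/funext => i; rewrite coef_fpsCM /fpsC; case: i => [|i] //=; rewrite mulr0.
Qed.

HB.instance Definition _ := GRing.isZmodMorphism.Build R (fps R) fpsC
  fpsC_is_zmod_morphism.
HB.instance Definition _ := GRing.isMonoidMorphism.Build R (fps R) fpsC
  fpsC_is_monoid_morphism.

Definition fpsX : fps R := fun i => (i == 1%N)%:R.

Lemma coef_fpsXM f i : (fpsX * f) i.+1 = f i.
Proof.
rewrite coef_fpsM big_ord_recl big_ord_recl /= /fpsX /= mul0r mul1r add0r.
by rewrite subSS subn0 big1 ?addr0 // => j _; rewrite mul0r.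
Qed.

Lemma coef_fpsXM0 f : (fpsX * f) 0%N = 0.
Proof. by rewrite coef_fpsM big_ord1 /fpsX mul0r. Qed.

End FormalPowerSeries.

(** * Expansions of 1/(c - X) *)

Section Geometric.
Variable R : realFieldType.
Implicit Types (f g h : fps R) (a b c : R) (i n : nat).

(* The expansion of [1 / (c - X)]. *)
Definition geo c : fps R := fun i => c ^- i.+1.

Lemma geoP c : c != 0 -> (fpsC c - fpsX R) * geo c = 1.
Proof.
move=> c0; rewrite mulrBl; apply/funext => -[|i]; rewrite coef_fpsB coef_fpsCM.
  by rewrite coef_fpsXM0 subr0 /geo expr1 mulfV.
by rewrite coef_fpsXM coef_fps1 /geo (exprS _ i.+1) invfM mulVKf // subrr.
Qed.

Lemma geo_sub a b : a != 0 -> b != 0 ->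
  geo a - geo b = fpsC (b - a) * (geo a * geo b).
Proof.
move=> a0 b0; transitivity (((fpsC b - fpsX R) * geo b) * geo a
  - ((fpsC a - fpsX R) * geo a) * geo b); first by rewrite !geoP // !mul1r.
ring.
Qed.

Lemma geoM_solve c f g : c != 0 -> (fpsC c - fpsX R) * f = g -> f = geo c * g.
Proof. by move=> c0 <-; rewrite mulrCA mulrA geoP ?mul1r. Qed.

End Geometric.

(** * Recurrences in k for the truncated sums F_q(k) *)

Section Transport.
Variable R : realFieldType.
Implicit Types (f g h : fps R) (a b c : R) (i j k m n q K N : nat).

(* The expansion of [1 / ((k + 1 - X) (k + 2 - X) ... (k + n - X))]. *)
Definition inv_rising k n : fps R := \prod_(i < n) geo (k + i).+1%:R.

Definition half_rising n : R := \prod_(i < n) (i%:R + 2^-1).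

Lemma half_risingS n : half_rising n.+1 = half_rising n * (n%:R + 2^-1).
Proof. by rewrite /half_rising big_ord_recr. Qed.

Lemma half_rising_ge0 n : 0 <= half_rising n.
Proof. by apply: prodr_ge0 => i _; apply: addr_ge0 => //; rewrite invr_ge0. Qed.

Lemma inv_rising0 k : inv_rising k 0 = 1.
Proof. by rewrite /inv_rising big_ord0. Qed.

Lemma inv_rising_recr k n :
  inv_rising k n.+1 = inv_rising k n * geo (k + n).+1%:R.
Proof. by rewrite /inv_rising big_ord_recr. Qed.

Lemma inv_rising_recl k n :
  inv_rising k n.+1 = geo k.+1%:R * inv_rising k.+1 n.
Proof.
rewrite /inv_rising big_ord_recl addn0; congr (_ * _).
by apply: eq_bigr => i _; rewrite addSnnS.
Qed.

(** For [n > 0] the products share all factors except 1/(k+1-X) in one and 1/(k+n+1-X) in the other,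
    whose difference has numerator n. *)
Lemma inv_rising_sub k n :
  inv_rising k n - inv_rising k.+1 n = fpsC n%:R * inv_rising k n.+1.
Proof.
case: n => [|n]; first by rewrite !inv_rising0 subrr rmorph0 mul0r.
rewrite [inv_rising k n.+1]inv_rising_recl [inv_rising k n.+2]inv_rising_recl.
rewrite [inv_rising k.+1 n.+1]inv_rising_recr.
rewrite [X in _ - X]mulrC -mulrBl geo_sub ?pnatr_eq0 //.
have -> : (k.+1 + n).+1%:R - k.+1%:R = n.+1%:R :> R.
  by rewrite -natrB; [congr (_%:R); lia | lia].
by rewrite -!mulrA; congr (_ * (_ * _)); rewrite mulrC.
Qed.

(** Times k + 1/2 - X = (k+n+1-X) - (n + 1/2), summand [n] becomes a difference of consecutive
    values of (1/2)_n / (k+1-X)_n. *)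
Lemma half_rising_telescope k N :
  (fpsC (k%:R + 2^-1) - fpsX R) *
     (\sum_(n < N) fpsC (half_rising n) * inv_rising k n.+1)
  = 1 - fpsC (half_rising N) * inv_rising k N.
Proof.
elim: N => [|N IH].
  rewrite big_ord0 mulr0 inv_rising0 /half_rising big_ord0 rmorph1.
  by rewrite mulr1 subrr.
rewrite big_ord_recr mulrDr IH /= half_risingS !inv_rising_recr.
have /geoP : ((k + N).+1%:R : R) != 0 by rewrite pnatr_eq0.
set G := geo _; have -> : ((k + N).+1%:R : R) = k%:R + N%:R + 1.
  by rewrite -natr1 natrD.
move: (inv_rising k N) (half_rising N) => P u geo1.
(* Inserting (k+N+1-X) G = 1 gives all terms the common factor G; splitting 1 as 1/2 + 1/2 then
   leaves a polynomial identity. *)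
have -> : fpsC u * P = fpsC u * P * ((fpsC (k%:R + N%:R + 1) - fpsX R) * G).
  by rewrite geo1 mulr1.
have -> : k%:R + N%:R + 1 = k%:R + N%:R + (2^-1 + 2^-1) :> R.
  by congr (_ + _); field.
rewrite !(rmorphM, rmorphD) /=.
ring.
Qed.

(** F_0(k) - F_0(k+1) truncated at [N]: the telescoping sum without its term [n = 0]. *)
Definition transport_tail N k : fps R :=
  \sum_(1 <= n < N.+1) fpsC (half_rising n) * inv_rising k n.+1.

Definition binom_sum N q k : fps R :=
  \sum_(1 <= n < N.+1) fpsC (half_rising n / n%:R ^+ q.+1) * inv_rising k n.

(** Dividing the telescoped identity by k + 1/2 - X and removing the term [n = 0], which is
    1/(k+1-X), leaves the limit and a remainder. *)
Lemma transport_tailE N k :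
  transport_tail N k = geo (k%:R + 2^-1) - geo k.+1%:R
    - geo (k%:R + 2^-1) * (fpsC (half_rising N.+1) * inv_rising k N.+1).
Proof.
have k0 : k%:R + 2^-1 != 0 :> R.
  by rewrite gt_eqF // ltr_wpDl // invr_gt0.
have := geoM_solve k0 (half_rising_telescope k N.+1).
rewrite mulrBr mulr1 addrAC => <-; rewrite big_ord_recl /transport_tail big_add1 /= big_mkord.
have -> : fpsC (half_rising 0) * inv_rising k 1 = geo k.+1%:R.
  by rewrite inv_rising_recl inv_rising0 mulr1 /half_rising big_ord0 rmorph1 mul1r.
by rewrite addrAC subrr add0r.
Qed.

Lemma binom_sum_sub0 N k :
  binom_sum N 0 k - binom_sum N 0 k.+1 = transport_tail N k.
Proof.
rewrite /binom_sum /transport_tail -sumrB; apply: eq_big_nat => n /andP[n1 _].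
rewrite -mulrBr inv_rising_sub mulrA -rmorphM /= expr1 divfK //.
by rewrite pnatr_eq0 -lt0n.
Qed.

Lemma binom_sum_subS N q k :
  binom_sum N q.+1 k - binom_sum N q.+1 k.+1
  = geo k.+1%:R * binom_sum N q k.+1.
Proof.
rewrite /binom_sum -sumrB mulr_sumr; apply: eq_big_nat => n /andP[n1 _].
rewrite -mulrBr inv_rising_sub [LHS]mulrA -rmorphM /= inv_rising_recl.
rewrite [LHS]mulrCA; congr (_ * (fpsC _ * _)).
have n0 : n%:R != 0 :> R by rewrite pnatr_eq0 -lt0n.
by rewrite (exprSr _ q.+1) invfM mulrA divfK.
Qed.

(* The coefficient of [y ^ j] in the product of the [1 + y / (l - X)],
   [1 <= l <= K]. *)
Fixpoint chain_coef j K : fps R :=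
  if K is K'.+1 then
    chain_coef j K' +
      (if j is j'.+1 then geo K%:R * chain_coef j' K' else 0)
  else (j == 0%N)%:R.

(** A sum of positive order at [K] equals the same sum at [K.+1] plus 1/(K+1-X) times the sum of
    next lower order, which reproduces the recurrence of [chain_coef]; the sum of order zero
    releases a tail. *)
Lemma binom_sum_chain N q K :
  binom_sum N q 0 =
    \sum_(j < q.+1) chain_coef j K * binom_sum N (q - j) K
    + \sum_(k < K) chain_coef q k * transport_tail N k.
Proof.
elim: K => [|K ->].
  rewrite big_ord0 addr0 big_ord_recl /= mul1r subn0 big1 ?addr0 // => j _.
  by rewrite mul0r.
rewrite [X in _ = _ + X]big_ord_recr /= [RHS]addrA [RHS]addrAC; congr (_ + _).
(* The index [j = q] is split off: only order zero has a tail as its difference. *)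
rewrite [in LHS]big_ord_recr /= subnn -[binom_sum N 0 K](subrK (binom_sum N 0 K.+1)).
rewrite binom_sum_sub0 mulrDr.
rewrite [RHS]addrC [LHS]addrCA; congr (_ + _).
under eq_bigr => j _.
  have -> : (q - j = (q - j.+1).+1)%N by have := ltn_ord j; lia.
  rewrite -[binom_sum N _ K](subrK (binom_sum N (q - j.+1).+1 K.+1)).
  rewrite binom_sum_subS mulrDr.
  have -> : ((q - j.+1).+1 = q - j)%N by have := ltn_ord j; lia.
  over.
rewrite big_split /= -addrA.
have -> : \sum_(j < q) chain_coef j K * binom_sum N (q - j) K.+1
    + chain_coef q K * binom_sum N 0 K.+1
  = \sum_(j < q.+1) chain_coef j K * binom_sum N (q - j) K.+1.
  by rewrite big_ord_recr /= subnn.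
rewrite [in LHS]big_ord_recl [in RHS]big_ord_recl /= addr0 addrCA.
congr (_ + _); rewrite -big_split /=; apply: eq_bigr => j _.
rewrite /bump /= add1n mulrDl addrC; congr (_ + _).
by rewrite mulrCA mulrA.
Qed.

End Transport.

(** * Coefficientwise bounds by comparison with X = 1/4 *)

Section Bounds.
Variable R : realFieldType.
Implicit Types (f g h : fps R) (a b c : R) (i j k m n q K N : nat).

Lemma fpsM_ge0 f g : (forall i, 0 <= f i) -> (forall i, 0 <= g i) ->
  forall i, 0 <= (f * g) i.
Proof. by move=> f0 g0 i; apply: sumr_ge0 => j _; apply: mulr_ge0. Qed.

Lemma ler_fpsM f f' g g' :
  (forall i, 0 <= f i <= f' i) -> (forall i, 0 <= g i <= g' i) ->
  forall i, (f * g) i <= (f' * g') i.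
Proof.
move=> ff gg i; apply: ler_sum => j _.
by have /andP[? ?] := ff j; have /andP[? ?] := gg (i - j)%N; apply: ler_pM.
Qed.

Lemma geo_ge0 c i : 0 <= c -> 0 <= geo c i.
Proof. by move=> c0; rewrite invr_ge0 exprn_ge0. Qed.

Lemma inv_rising_ge0 k n i : 0 <= inv_rising R k n i.
Proof.
elim: n i => [|n IH] i; first by rewrite inv_rising0 coef_fps1.
by rewrite inv_rising_recr; apply: fpsM_ge0 => // ?; apply: geo_ge0.
Qed.

Lemma chain_coef_ge0 j K i : 0 <= chain_coef R j K i.
Proof.
elim: K j i => [|K IH] j i.
  rewrite [chain_coef _ _ _]/=; case: (j == 0%N); last by rewrite mulr0n lexx.
  by rewrite mulr1n coef_fps1.
rewrite [chain_coef _ _ _]/=; case: j => [|j]; first by rewrite addr0.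
by rewrite addr_ge0 //; apply: fpsM_ge0 => // ?; apply: geo_ge0.
Qed.

Lemma ler_geo b c i : 0 < b -> b <= c -> geo c i <= geo b i.
Proof.
move=> b0 bc; have c0 := lt_le_trans b0 bc.
by rewrite lef_pV2 ?posrE ?exprn_gt0 // lerXn2r // nnegrE ltW.
Qed.

(** The gain comes from the first factor, as 1/(k+1-X) is dominated by 1/(k+1) times 1/(1-X); the
    other factors only shrink as k grows. *)
Lemma ler_inv_rising k n i : (0 < n)%N ->
  inv_rising R k n i <= inv_rising R 0 n i / k.+1%:R.
Proof.
case: n => // n _; rewrite !inv_rising_recl.
have mono l : inv_rising R k.+1 n l <= inv_rising R 1 n l.
  elim: n l => [|n IH] l; first by rewrite !inv_rising0.
  rewrite !inv_rising_recr; apply: ler_fpsM => t.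
    by rewrite IH inv_rising_ge0.
  by rewrite geo_ge0 //= ler_geo // ler_nat; lia.
rewrite [leRHS](_ : _ = (fpsC k.+1%:R^-1 * geo 1%:R * inv_rising R 1 n) i); last first.
  by rewrite -mulrA coef_fpsCM mulrC.
apply: ler_fpsM => t; last first.
  by rewrite mono inv_rising_ge0.
rewrite geo_ge0 //= coef_fpsCM /geo expr1n invr1 mulr1 exprS invfM.
by rewrite ler_piMr ?invr_ge0 // invf_le1 ?exprn_gt0 // exprn_ege1 // ler1n.
Qed.

Lemma binom_sum_ge0 N q k i : 0 <= binom_sum R N q k i.
Proof.
rewrite /binom_sum coef_fps_sum; apply: sumr_ge0 => n _.
by rewrite coef_fpsCM mulr_ge0 ?inv_rising_ge0 // divr_ge0 ?half_rising_ge0 ?exprn_ge0.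
Qed.

Lemma ler_binom_sum N q k i :
  binom_sum R N q k i <= binom_sum R N 0 0 i / k.+1%:R.
Proof.
rewrite /binom_sum !coef_fps_sum mulr_suml; apply: ler_sum_nat => n /andP[n1 _].
rewrite !coef_fpsCM -mulrA; apply: ler_pM.
- by rewrite divr_ge0 ?half_rising_ge0 ?exprn_ge0.
- exact: inv_rising_ge0.
- rewrite ler_wpM2l ?half_rising_ge0 // lef_pV2 ?posrE ?exprn_gt0 ?ltr0n //.
  by rewrite ler_weXn2l // ler1n.
- exact: ler_inv_rising.
Qed.

(** The subtracted series have nonnegative coefficients; the bound is uniform in [N]. *)
Lemma transport_tail_le N i : transport_tail R N 0 i <= geo (2^-1) i.
Proof.
rewrite transport_tailE add0r !coef_fpsB -addrA gerDl -opprD oppr_le0.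
rewrite addr_ge0 ?geo_ge0 //; apply: fpsM_ge0 => t; first by rewrite geo_ge0 // invr_ge0.
by rewrite coef_fpsCM mulr_ge0 ?half_rising_ge0 ?inv_rising_ge0.
Qed.

(* [binom_sum N 0 0 - binom_sum N 0 1] is bounded and the second term is at
   most half of the first. *)
Lemma binom_sum_bound N q k i :
  binom_sum R N q k i <= 2 ^+ i.+2 / k.+1%:R.
Proof.
apply: le_trans (ler_binom_sum _ _ _ _) _; rewrite ler_wpM2r ?invr_ge0 //.
have h1 := ler_binom_sum N 0 1 i.
have := congr1 (fun f => f i) (binom_sum_sub0 R N 0); rewrite /= coef_fpsB => h2.
have h3 := transport_tail_le N i; rewrite /geo exprVn invrK in h3.
have : 2 ^+ i.+2 = 2 * 2 ^+ i.+1 :> R by rewrite exprS.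
lra.
Qed.

(** The product g satisfies c g_(i+1) = f_(i+1) + g_i, a recurrence met with equality by t 4^i, t =
    a/(c - 1/4), when f_i = a 4^i. The factor 1/(c - 1/4) is 1/(c - X) at X = 1/4. *)
Lemma geoM_le c f a : 1 <= c -> 0 <= a -> (forall i, f i <= a * 4 ^+ i) ->
  forall i, (geo c * f) i <= a / (c - 4^-1) * 4 ^+ i.
Proof.
move=> c1 a0 fle.
have c0 : c != 0 by lra.
have d0 : 0 < c - 4^-1 by lra.
have := geoP c0 => /(congr1 ( *%R^~ f)); rewrite mul1r -mulrA mulrBl.
set g := geo c * f => gE.
have aE : a = a / (c - 4^-1) * (c - 4^-1) by rewrite divfK // gt_eqF.
have t0 : 0 <= a / (c - 4^-1) by rewrite divr_ge0 // ltW.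
elim=> [|i IH]; rewrite -(ler_pM2l (lt_le_trans ltr01 c1)).
  have /(congr1 (fun f => f 0%N)) := gE.
  rewrite coef_fpsB coef_fpsCM coef_fpsXM0 subr0 => ->.
  by apply: le_trans (fle 0%N) _; rewrite !expr0; nra.
have /(congr1 (fun f => f i.+1)) := gE.
rewrite coef_fpsB coef_fpsCM coef_fpsXM => /eqP; rewrite subr_eq => /eqP ->.
apply: le_trans (lerD (fle i.+1) IH) _.
set t := a / (c - 4^-1) in aE *; rewrite aE exprS.
by move: (4 ^+ i) => z; rewrite le_eqVlt; apply/predU1P; left; field.
Qed.

(** The value of (1-X)...(n-X) at X = 1/4. *)
Definition three_quarter_rising n : R := \prod_(i < n) (i%:R + 3 / 4).

Lemma three_quarter_risingS n :
  three_quarter_rising n.+1 = three_quarter_rising n * (n%:R + 3 / 4).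
Proof. by rewrite /three_quarter_rising big_ord_recr. Qed.

Lemma three_quarter_rising_gt0 n : 0 < three_quarter_rising n.
Proof. by apply: prodr_gt0 => i _; rewrite ltr_wpDl // divr_gt0. Qed.

Lemma inv_rising_bound n i :
  inv_rising R 0 n i <= 4 ^+ i / three_quarter_rising n.
Proof.
elim: n i => [|n IH] i.
  rewrite inv_rising0 coef_fps1 /three_quarter_rising big_ord0 divr1.
  by case: i => [|i] /=; rewrite ?expr0 ?exprn_ge0.
rewrite inv_rising_recr add0n mulrC three_quarter_risingS invfM [leRHS]mulrC.
have -> : n%:R + 3 / 4 = n.+1%:R - 4^-1 :> R by rewrite -natr1; field.
apply: geoM_le; first by rewrite ler1n.
- by rewrite invr_ge0 ltW ?three_quarter_rising_gt0.
- by move=> l; rewrite mulrC; apply: IH.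
Qed.

(** At X = y = 1/4 the product of the 1 + y/(l-X) is that of the l/(l - 1/4), namely K!/(3/4)_K; a
    coefficient of y^j is at most 4^j times this. *)
Lemma chain_coef_bound j K i :
  chain_coef R j K i <= 4 ^+ j * (K`!%:R / three_quarter_rising K) * 4 ^+ i.
Proof.
have r_ge0 l : 0 <= l`!%:R / three_quarter_rising l.
  by rewrite divr_ge0 // ltW // three_quarter_rising_gt0.
elim: K j i => [|K IH] j i.
  rewrite /three_quarter_rising big_ord0 fact0 divr1 mulr1 [chain_coef _ _ _]/=.
  case: j => [|j]; last by rewrite mulr0n mulr_ge0 ?exprn_ge0.
  rewrite mulr1n coef_fps1 expr0 mul1r.
  by case: i => [|i] /=; rewrite ?expr0 ?exprn_ge0.
rewrite [chain_coef _ _ _]/= three_quarter_risingS factS natrM invfM.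
set r := K`!%:R / three_quarter_rising K in IH.
have r0 : 0 <= r by apply: r_ge0.
have K0 : 0 <= K%:R :> R by [].
have -> : K.+1%:R * K`!%:R * ((three_quarter_rising K)^-1 / (K%:R + 3 / 4))
   = r * (1 + 4^-1 / (K%:R + 3 / 4)).
  rewrite /r -natr1; field.
  by rewrite !gt_eqF ?three_quarter_rising_gt0 //; lra.
have s0 : 0 <= 4^-1 / (K%:R + 3 / 4) :> R by apply: divr_ge0; lra.
case: j => [|j].
  rewrite addr0; apply: le_trans (IH _ _) _.
  by rewrite ler_wpM2r ?exprn_ge0 // ler_wpM2l ?exprn_ge0 // ler_peMr //; lra.
rewrite coef_fpsD; apply: le_trans (lerD (IH _ _) (geoM_le _ _ (IH j) i)) _.
- by rewrite ler1n.
- by rewrite mulr_ge0 ?exprn_ge0.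
have -> : K.+1%:R - 4^-1 = K%:R + 3 / 4 :> R by rewrite -natr1; field.
rewrite le_eqVlt; apply/predU1P; left; rewrite (exprS 4 j); field; lra.
Qed.

(** The ratio decays like n^(-1/4), hence the fourth power. *)
Lemma half_over_three_quarter n :
  (half_rising R n / three_quarter_rising n) ^+ 4 <= n.+1%:R^-1.
Proof.
elim: n => [|n IH].
  by rewrite /half_rising /three_quarter_rising !big_ord0 divr1 expr1n invr1.
rewrite half_risingS three_quarter_risingS invfM mulrACA exprMn.
have key (x : R) : 0 <= x ->
    (x + 1)^-1 * ((x + 2^-1) / (x + 3 / 4)) ^+ 4 <= (x + 1 + 1)^-1.
  move=> x0; rewrite expr_div_n ler_pdivrMl; last lra.
  rewrite ler_pdivrMr; last by rewrite exprn_gt0; lra.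
  rewrite mulrAC ler_pdivlMr; last lra.
  rewrite -subr_ge0.
  (* The terms of degree 5 and 4 cancel, leaving a cubic with positive coefficients. *)
  have -> : (x + 1) * (x + 3 / 4) ^+ 4 - (x + 2^-1) ^+ 4 * (x + 1 + 1)
    = 7 / 8 * x ^+ 3 + 25 / 16 * x ^+ 2 + 241 / 256 * x + 49 / 256 by field.
  have := exprn_ge0 2 x0; have := exprn_ge0 3 x0; lra.
apply: le_trans (ler_wpM2r _ IH) _; last by rewrite -[n.+2%:R]natr1 -[n.+1%:R]natr1 key.
by rewrite exprn_ge0 // divr_ge0 // addr_ge0 // divr_ge0.
Qed.

(** The growth is really of order K^(1/4); a square root suffices against the factor 1/(K+1) of the
    remainder. *)
Lemma fact_over_three_quarter K :
  (K`!%:R / three_quarter_rising K) ^+ 2 <= K.+1%:R.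
Proof.
elim: K => [|K IH].
  by rewrite /three_quarter_rising big_ord0 fact0 divr1 expr1n.
rewrite factS mulnC natrM three_quarter_risingS invfM mulrACA exprMn.
have key (x : R) : 0 <= x ->
    (x + 1) * ((x + 1) / (x + 3 / 4)) ^+ 2 <= x + 1 + 1.
  move=> x0; rewrite expr_div_n mulrA ler_pdivrMr; last by rewrite exprn_gt0; lra.
  nra.
apply: le_trans (ler_wpM2r _ IH) _; last by rewrite -[K.+2%:R]natr1 -[K.+1%:R]natr1 key.
by rewrite exprn_ge0 // divr_ge0 // addr_ge0 // divr_ge0.
Qed.

End Bounds.

(** * Passage to the limit, first in N and then in K *)

Section Limits.
Variable R : realType.
Implicit Types (f g h : fps R) (a b c : R) (i j k m n q K N : nat).

(** Fourth powers let a decay of order n^(-1/4) be used without real roots. *)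
Lemma cvg0_expr4 (v : nat -> R) a : (forall n, 0 <= v n) ->
  (forall n, v n ^+ 4 <= a / n.+1%:R) -> v @ \oo --> (0 : R).
Proof.
move=> v0 v4; apply/cvgrPdist_lt => e e0.
have a0 : (fun n => a / n.+1%:R) @ \oo --> (0 : R).
  by rewrite -[X in _ --> X](mulr0 a); apply: cvgMl_tmp; apply: cvg_harmonic.
have e4 : 0 < e ^+ 4 by rewrite exprn_gt0.
move/cvgrPdist_lt : a0 => /(_ _ e4); apply: filterS => n.
rewrite !sub0r !normrN (ger0_norm (v0 n)) => h.
rewrite ltNge; apply/negP => ev.
have : e ^+ 4 <= v n ^+ 4 by rewrite ler_pXn2r // nnegrE // ltW.
move=> /le_trans /(_ (v4 n)) /le_trans /(_ (ler_norm _)).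
by rewrite leNgt h.
Qed.

Lemma cvg_coef_fpsM g (f : nat -> fps R) (l : fps R) :
  (forall i, f ^~ i @ \oo --> l i) ->
  forall i, (fun N => (g * f N) i) @ \oo --> (g * l) i.
Proof.
move=> fl i; rewrite coef_fpsM; under eq_fun do rewrite coef_fpsM.
apply: cvg_big => [|j _]; first exact: add_continuous.
by apply: cvgMl_tmp; apply: fl.
Qed.

Lemma half_inv_rising_cvg0 k i :
  (fun N => half_rising R N * inv_rising R k N i) @ \oo --> (0 : R).
Proof.
apply: (@cvg0_expr4 _ ((4 ^+ i) ^+ 4)) => n.
  by rewrite mulr_ge0 ?half_rising_ge0 ?inv_rising_ge0.
apply: (@le_trans _ _ ((4 ^+ i * (half_rising R n / three_quarter_rising R n)) ^+ 4)).
  rewrite lerXn2r ?nnegrE ?mulr_ge0 ?half_rising_ge0 ?inv_rising_ge0 //.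
    by rewrite invr_ge0 ltW // three_quarter_rising_gt0.
  rewrite mulrCA ler_wpM2l ?half_rising_ge0 //.
  apply: le_trans _ (inv_rising_bound R n i).
  case: n => [|n]; first by rewrite !inv_rising0.
  apply: le_trans (ler_inv_rising R k i (ltn0Sn n)) _.
  by rewrite ler_piMr ?inv_rising_ge0 // invf_le1 // ler1n.
by rewrite exprMn ler_wpM2l ?exprn_ge0 // half_over_three_quarter.
Qed.

Lemma cvg_transport_tail k i :
  (fun N => transport_tail R N k i) @ \oo -->
    (geo (k%:R + 2^-1) - geo k.+1%:R : fps R) i.
Proof.
set u := fun N => fpsC (half_rising R N.+1) * inv_rising R k N.+1.
have -> : transport_tail R ^~ k ^~ i =
    (fun N => (geo (k%:R + 2^-1) - geo k.+1%:R : fps R) i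
              - (geo (k%:R + 2^-1) * u N) i).
  by apply/funext => N; rewrite transport_tailE.
rewrite -[X in _ --> X]subr0; apply: cvgB; first exact: cvg_cst.
have -> : (0 : R) = (geo (k%:R + 2^-1) * (0 : fps R)) i by rewrite mulr0.
apply: cvg_coef_fpsM => l.
rewrite (_ : (fun N => u N l) =
    (fun N => half_rising R N.+1 * inv_rising R k N.+1 l)); last first.
  by apply/funext => N; rewrite /u coef_fpsCM.
by rewrite (cvg_shiftS (fun N => half_rising R N * inv_rising R k N l));
  apply: half_inv_rising_cvg0.
Qed.

(** One constant serves all [N] and [K], so [N] can go to infinity first; 1/(K+1) comes from
    [binom_sum_bound]. *)
Lemma chain_remainder_bound q i : exists a, forall N K,
  (\sum_(j < q.+1) chain_coef R j K * binom_sum R N (q - j) K) i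
   <= a * (K`!%:R / three_quarter_rising R K / K.+1%:R).
Proof.
exists (\sum_(j < q.+1) \sum_(l < i.+1) 4 ^+ j * 4 ^+ l * 2 ^+ (i - l).+2).
move=> N K; rewrite coef_fps_sum mulr_suml; apply: ler_sum => j _.
rewrite coef_fpsM mulr_suml; apply: ler_sum => l _.
apply: (le_trans (ler_pM _ _ (chain_coef_bound _ _ _ _) (binom_sum_bound _ _ _ _ _))).
- exact: chain_coef_ge0.
- exact: binom_sum_ge0.
rewrite le_eqVlt; apply/predU1P; left.
move: (4 ^+ j) (4 ^+ l) (2 ^+ _) (K`!%:R / _) (K.+1%:R^-1) => x y z t u.
ring.
Qed.

Lemma fact_over_rising_cvg0 :
  (fun K => K`!%:R / three_quarter_rising R K / K.+1%:R) @ \oo --> (0 : R).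
Proof.
have r0 K : 0 <= K`!%:R / three_quarter_rising R K.
  by rewrite divr_ge0 // ltW // three_quarter_rising_gt0.
apply: (@cvg0_expr4 _ 1) => K; first by rewrite divr_ge0.
rewrite expr_div_n (exprM _ 2 2) ler_pdivrMr ?exprn_gt0 ?ltr0n //.
apply: (@le_trans _ _ (K.+1%:R ^+ 2)).
  by rewrite lerXn2r ?nnegrE ?exprn_ge0 // fact_over_three_quarter.
have n0 : K.+1%:R != 0 :> R by rewrite pnatr_eq0.
have -> : 1 / K.+1%:R * K.+1%:R ^+ 4 = K.+1%:R ^+ 3 :> R by field.
by rewrite ler_weXn2l // ler1n.
Qed.

(** Bounded monotone sums converge in [N]. In the limit of [binom_sum_chain] at fixed [K] the
    remainder stays nonnegative and uniformly bounded, and it vanishes as [K] grows. *)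
Lemma cvg_binom_sum q i : exists l : R,
  (fun N => binom_sum R N q 0 i) @ \oo --> l /\
  (fun K => \sum_(k < K)
     (chain_coef R q k * (geo (k%:R + 2^-1) - geo k.+1%:R)) i) @ \oo --> l.
Proof.
have : cvgn (fun N => binom_sum R N q 0 i).
  apply: nondecreasing_is_cvgn.
    apply/nondecreasing_seqP => N; rewrite /binom_sum [in leRHS]big_nat_recr //=.
    rewrite coef_fpsD lerDl coef_fpsCM mulr_ge0 ?inv_rising_ge0 //.
    by rewrite divr_ge0 ?half_rising_ge0 ?exprn_ge0.
  exists (2 ^+ i.+2 / 1%:R) => _ [N _ <-]; exact: binom_sum_bound.
move=> /cvg_ex[/= l bl]; exists l; split => //.
have [a ra] := chain_remainder_bound q i.
set V := fun k => (geo (k%:R + 2^-1) - geo k.+1%:R : fps R).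
set S := fun K => _.
have bnd K : 0 <= l - S K <= a * (K`!%:R / three_quarter_rising R K / K.+1%:R).
  have cv : (fun N => binom_sum R N q 0 i -
      \sum_(k < K) (chain_coef R q k * transport_tail R N k) i) @ \oo --> l - S K.
    apply: cvgB => //; apply: cvg_big => [|k _]; first exact: add_continuous.
    by apply: cvg_coef_fpsM => t; apply: cvg_transport_tail.
  have eqr N : binom_sum R N q 0 i -
      \sum_(k < K) (chain_coef R q k * transport_tail R N k) i =
      (\sum_(j < q.+1) chain_coef R j K * binom_sum R N (q - j) K) i.
    by rewrite [in LHS](binom_sum_chain R N q K) coef_fpsD
      (coef_fps_sum _ _ (fun k : 'I_K => chain_coef R q k * _)) addrK.
  rewrite (funext eqr) in cv.
  apply/andP; split.
    apply: (cvgr_to_ge cv); near=> N; rewrite coef_fps_sum; apply: sumr_ge0 => j _.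
    by apply: fpsM_ge0 => t; [apply: chain_coef_ge0 | apply: binom_sum_ge0].
  by apply: (cvgr_to_le cv); near=> N; apply: ra.
have e0 : (fun K => a * (K`!%:R / three_quarter_rising R K / K.+1%:R)) @ \oo --> (0 : R).
  by rewrite -[X in _ --> X](mulr0 a); apply: cvgMl_tmp; apply: fact_over_rising_cvg0.
have d0 : (fun K => l - S K) @ \oo --> (0 : R).
  apply: squeeze_cvgr (cvg_cst 0) e0; near=> K; exact: bnd.
rewrite (_ : S = (fun K => l - (l - S K))); last first.
  by apply/funext => K; rewrite subKr.
by rewrite -[X in _ --> X]subr0; apply: cvgB => //; apply: cvg_cst.
Unshelve. all: by end_near.
Qed.

End Limits.

(** * Truncated multiple sums over tuples as iterated sums *)

Lemma big_tuple_cons (A : nmodType) (I : finType) m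
    (P : pred (m.+1.-tuple I)) (F : m.+1.-tuple I -> A) :
  \sum_(t | P t) F t =
  \sum_(i : I) \sum_(t : m.-tuple I | P [tuple of i :: t]) F [tuple of i :: t].
Proof.
pose h (u : I * m.-tuple I) := [tuple of u.1 :: u.2].
rewrite pair_big_dep (reindex h) //=; apply: onW_bij; apply: inj_card_bij.
  by move=> [i t] [j u] /(congr1 val)[/= -> /val_inj ->].
by rewrite card_prod !card_tuple expnS.
Qed.

Lemma big_tuple_rcons (A : nmodType) (I : finType) m
    (P : pred (m.+1.-tuple I)) (F : m.+1.-tuple I -> A) :
  \sum_(t | P t) F t =
  \sum_(i : I) \sum_(t : m.-tuple I | P [tuple of rcons t i])
    F [tuple of rcons t i].
Proof.
pose h (u : I * m.-tuple I) := [tuple of rcons u.2 u.1].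
rewrite pair_big_dep (reindex h) //=; apply: onW_bij; apply: inj_card_bij.
  by move=> [i t] [j u] /(congr1 val)/= /rcons_inj[/val_inj -> ->].
by rewrite card_prod !card_tuple expnS.
Qed.

Lemma big_ord_nat_range (A : nmodType) N a b (F : nat -> A) : (b <= N)%N ->
  \sum_(j < N | (a <= j < b)%N) F j = \sum_(a <= j < b) F j.
Proof.
move=> bN; rewrite (big_nat_widen _ _ _ xpredT _ bN) big_geq_mkord.
by apply: eq_bigl => j; rewrite /= andbC.
Qed.

Section Combinatorics.
Variable R : realType.
Implicit Types (s : seq (nat * decoration)) (m n p q w N : nat).

Let zeta_star_gf n : fps R := fpsC n`!%:R * inv_rising R 0 n.

(** Writing g_n for the generating function, compare coefficients of degree m+1 in (n+1-X) g_(n+1) =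
    (n+1) g_n. *)
Lemma zeta_star_gfS n m :
  zeta_star_gf n m.+1 = \sum_(1 <= j < n.+1) j%:R^-1 * zeta_star_gf j m.
Proof.
elim: n => [|n IH].
  by rewrite big_geq // /zeta_star_gf coef_fpsCM inv_rising0 coef_fps1 mulr0.
rewrite big_nat_recr //= -IH.
have n0 : n.+1%:R != 0 :> R by rewrite pnatr_eq0.
have E : (fpsC n.+1%:R - fpsX R) * zeta_star_gf n.+1 = fpsC n.+1%:R * zeta_star_gf n.
  rewrite /zeta_star_gf inv_rising_recr add0n factS natrM rmorphM /=.
  by rewrite !mulrA [LHS]mulrC !mulrA [geo _ * _]mulrC geoP // mul1r.
move: E => /(congr1 (fun f => f m.+1)).
rewrite mulrBl coef_fpsB !coef_fpsCM coef_fpsXM => /eqP.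
rewrite subr_eq => /eqP /(congr1 ( *%R n.+1%:R^-1)).
by rewrite mulrDr !mulKf.
Qed.

Lemma zeta_star_onesE n m : zeta_star_ones R n m = n`!%:R * inv_rising R 0 n m.
Proof.
rewrite -coef_fpsCM -/(zeta_star_gf n).
(* The bound [i] on the largest index is separated from the type bound [N], so that the tail of a
   tuple, bounded by its head, falls under the induction hypothesis. *)
have star N m' i : (i <= N)%N ->
    \sum_(t : m'.-tuple 'I_N.+1 |
       path geq i (map val t) && all (leq 1) (map val t))
      \prod_(x <- t) (x%:R : R)^-1 = zeta_star_gf i m'.
  elim: m' i => [|m' IH] i iN.
    rewrite (big_pred1 [tuple]); last by move=> t; rewrite tuple0.
    rewrite big_nil /zeta_star_gf coef_fpsCM.
    elim: i {iN} => [|i IH]; first by rewrite inv_rising0 coef_fps1 mulr1.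
    rewrite inv_rising_recr factS natrM coef_fpsM big_ord1 /geo expr1 add0n.
    by rewrite [X in _ * X]mulrC mulrACA mulfV ?pnatr_eq0 // mul1r.
  rewrite big_tuple_cons zeta_star_gfS -(@big_ord_nat_range _ N.+1) //.
  rewrite [RHS]big_mkcond; apply: eq_bigr => j _ /=.
  have [/andP[j1 ji]|jni] := boolP (1 <= j < i.+1)%N; last first.
    rewrite big1 // => t /andP[/andP[ji _] /andP[j1 _]].
    by rewrite /= ltnS j1 ji in jni.
  rewrite -IH; last by rewrite -ltnS.
  rewrite big_distrr; apply: eq_big => [t|t _].
    by rewrite j1 /= ; rewrite ltnS in ji; rewrite ji.
  by rewrite /= big_cons.
rewrite -(star n m n (leqnn n)); apply: eq_bigl => t; congr (_ && _).
case: (tval t) => //= x l; have := ltn_ord x; rewrite ltnS => ->.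
by [].
Qed.

(** The bound [n] is strict, like the decrease of the indices; truncation at [N] is thus the value
    at [N.+1]. *)
Fixpoint nested s n : R :=
  if s is (a, d) :: s' then
    \sum_(1 <= j < n) eps R d j / j%:R ^+ a * nested s' j
  else 1.

Lemma mmzv_partialE s N : mmzv_partial R s N = nested s N.+1.
Proof.
have key i : (i <= N.+1)%N ->
    \sum_(t : (size s).-tuple 'I_N.+1 |
       path gtn i (map val t) && all (leq 1) (map val t))
    \prod_(j < size s)
       (eps R (tnth (in_tuple s) j).2 (tnth t j)
          / (tnth t j)%:R ^+ (tnth (in_tuple s) j).1) = nested s i.
  elim: s i => [|[a d] s IH] i iN.
    rewrite (big_pred1 [tuple]); last by move=> t; rewrite tuple0.
    by rewrite big_ord0.
  rewrite big_tuple_cons [RHS]/= -(@big_ord_nat_range _ N.+1) //.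
  rewrite [RHS]big_mkcond; apply: eq_bigr => j _ /=.
  have [/andP[j1 ji]|jni] := boolP (1 <= j < i)%N; last first.
    rewrite big1 // => t /andP[/andP[ji _] /andP[j1 _]].
    by rewrite j1 ji in jni.
  rewrite -IH; last by rewrite ltnW // ltn_ord.
  rewrite big_distrr; apply: eq_big => [t|t _].
    by rewrite j1 ji.
  rewrite big_ord_recl; congr (_ * _).
  by apply: eq_bigr => l _; rewrite !(tnth_nth (0%N, Plain)) !(tnth_nth j).
rewrite -key //; apply: eq_bigl => t; congr (_ && _).
by case: (tval t) => //= x l; rewrite ltn_ord.
Qed.

End Combinatorics.

(** * Generating functions for sums over compositions *)

Section SumOverCompositions.
Variable R : realType.
Implicit Types (m n p q w N : nat).

Definition hats (ks : seq nat) := [seq (x, Hat) | x <- ks].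

(* Its coefficient of degree [e] is the sum of [nested (hats ks) n] over the
   compositions [ks] of [e + q] into [q] parts. *)
Fixpoint hat_sum q n : fps R :=
  if q is q'.+1 then
    \sum_(1 <= l < n) fpsC (eps R Hat l) * (geo l%:R * hat_sum q' l)
  else 1.

(** Peeling off the first part [a] gives a Cauchy product: l^(-a) is the coefficient of degree a-1
    in 1/(l-X), whence the shift [s - p]. As [s < w], every part fits in the index type. *)
Lemma nested_hats_sum w p n s : (s < w)%N ->
  \sum_(k : p.-tuple 'I_w | all (leq 1) (map val k) && (sumn (map val k) == s))
     nested R (hats (map val k)) n =
  if (p <= s)%N then hat_sum p n (s - p)%N else 0.
Proof.
elim: p n s => [|p IH] n s sw.
  rewrite big_mkcond (big_pred1 [tuple]); last by move=> t; apply/esym/eqP/tuple0.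
  rewrite /= subn0 coef_fps1 eq_sym; by case: (s == 0%N).
rewrite big_tuple_cons.
have step (a : 'I_w) :
    \sum_(t : p.-tuple 'I_w | all (leq 1) (map val [tuple of a :: t])
        && (sumn (map val [tuple of a :: t]) == s))
      nested R (hats (map val [tuple of a :: t])) n =
    \sum_(1 <= l < n) eps R Hat l * (if (1 <= a < (s - p).+1)%N && (p < s)%N
       then l%:R ^- a * hat_sum p l (s - p - a)%N else 0).
  rewrite /= exchange_big /=; apply: eq_bigr => l _.
  have [a1|] := boolP (1 <= a)%N; last by rewrite big_pred0 ?mulr0 // => t; rewrite (negbTE _).
  have [as_|sa] := leqP a s; last first.
    rewrite big_pred0 => [|t]; last first.
      by rewrite /=; apply/negbTE/negP => /andP[_ /eqP]; lia.
    by rewrite ifF ?mulr0 //; lia.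
  rewrite -big_distrr /= -mulrA; congr (_ * _).
  rewrite (eq_bigl (fun t : p.-tuple 'I_w => all (leq 1) (map val t) &&
     (sumn (map val t) == s - a)%N)); last first.
    by move=> t /=; congr (_ && _); apply/eqP/eqP; lia.
  rewrite IH; last by lia.
  rewrite -[RHS]/(if _ then _ else _).
  have [h|h] := leqP p (s - a)%N.
    by rewrite ifT; [congr (_ * hat_sum _ _ _); lia | lia].
  by rewrite ifF ?mulr0 //; lia.
under eq_bigr do rewrite step.
rewrite exchange_big /=.
case: (ltnP p s) => [ps|sp]; last first.
  by rewrite big1 // => l _; rewrite big1 // => a _; rewrite andbF mulr0.
rewrite coef_fps_sum; apply: eq_bigr => l _.
rewrite coef_fpsCM -big_distrr; congr (_ * _).
under eq_bigr do rewrite andbT.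
rewrite -big_mkcond (@big_ord_nat_range _ _ _ _
  (fun a => l%:R ^- a * hat_sum p l (s - p - a)%N)); last by lia.
rewrite big_add1 big_mkord coef_fpsM /=.
have -> : (s - p = (s - p.+1).+1)%N by lia.
by apply: eq_bigr => i _; rewrite /geo subSS.
Qed.

(** The summand of [mmzv R (rhs_args k)] at outermost index [n], without its sign. *)
Definition tail_sum p w (k : p.+1.-tuple 'I_w) n : R :=
  nested R (behead (rhs_args k)) n / n%:R ^+ last 0%N (map val k).

Lemma admissible_sum m p n : let w := (m + p + 2)%N in
  \sum_(k : p.+1.-tuple 'I_w | admissible k) tail_sum k n
  = (geo n%:R * hat_sum p.+1 n) m.
Proof.
move=> w; rewrite big_tuple_rcons.
have step (a : 'I_w) :
    \sum_(t : p.-tuple 'I_w | admissible [tuple of rcons t a])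
       tail_sum [tuple of rcons t a] n =
    if (1 <= a < m.+2)%N then n%:R ^- a * hat_sum p.+1 n (m.+1 - a)%N else 0.
  have aw := ltn_ord a.
  have admE (t : p.-tuple 'I_w) : admissible [tuple of rcons t a] =
      [&& all (leq 1) (map val t), (0 < a)%N & (sumn (map val t) + a <= w - 1)%N].
    rewrite /admissible /= map_rcons all_rcons sumn_rcons andbA.
    by congr (_ && _); rewrite andbC.
  rewrite (eq_bigl _ _ admE).
  have [a0|a_gt0] := posnP a.
    by rewrite big_pred0 ?a0 // => t; rewrite andbF.
  transitivity (n%:R ^- a * \sum_(k : p.+1.-tuple 'I_w |
     all (leq 1) (map val k) && (sumn (map val k) == w - a)%N)
     nested R (hats (map val k)) n).
    rewrite big_tuple_cons (exchange_big_dep (fun t : p.-tuple 'I_w =>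
      [&& all (leq 1) (map val t), (0 < a)%N & (sumn (map val t) + a <= w - 1)%N])) /=;
      last first.
      move=> b t _ /andP[/andP[b0 ->] /eqP e].
      by rewrite a_gt0 /=; lia.
    rewrite big_distrr; apply: eq_big => [t|t /andP[tall ta]] /=; first by rewrite a_gt0.
    (* The first part is determined by the others, so the inner sum has one term. *)
    have bw : (w - (sumn (map val t) + a) < w)%N by lia.
    rewrite (big_pred1 (Ordinal bw)) => [|b]; last first.
      rewrite tall andbT; apply/andP/eqP => [[_ /eqP e]|->].
        by apply: val_inj => /=; lia.
      by split => //=; [lia | apply/eqP; lia].
    rewrite /tail_sum /rhs_args [behead _]/= map_rcons last_rcons mulrC sumn_rcons.
    by rewrite -cats1 take_cat size_map size_tuple ltnn subnn cats0.
  rewrite nested_hats_sum; last by lia.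
  have [h|h] := leqP p.+1 (w - a)%N.
    by rewrite ifT; [congr (_ * hat_sum _ _ _); lia | lia].
  by rewrite ifF ?mulr0 //; lia.
under eq_bigr do rewrite step.
rewrite -big_mkcond (@big_ord_nat_range _ _ _ _
  (fun a => n%:R ^- a * hat_sum p.+1 n (m.+1 - a)%N)); last by lia.
rewrite big_add1 big_mkord coef_fpsM /=.
by apply: eq_bigr => i _; rewrite /geo subSS.
Qed.

(** The substitution of cX for X. *)
Definition fps_scale c (f : fps R) : fps R := fun i => c ^+ i * f i.

Lemma fps_scaleD c f g : fps_scale c (f + g) = fps_scale c f + fps_scale c g.
Proof. by apply/funext => i; rewrite /fps_scale !coef_fpsD mulrDr. Qed.

Lemma fps_scaleB c f g : fps_scale c (f - g) = fps_scale c f - fps_scale c g.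
Proof. by apply/funext => i; rewrite /fps_scale !coef_fpsB mulrBr. Qed.

Lemma fps_scaleM c f g : fps_scale c (f * g) = fps_scale c f * fps_scale c g.
Proof.
apply/funext => i; rewrite /fps_scale !coef_fpsM big_distrr /=.
apply: eq_bigr => j _; rewrite mulrACA -exprD subnKC //.
by rewrite -ltnS.
Qed.

Lemma fps_scale_geo c : fps_scale 2 (geo (2 * c)) = fpsC 2^-1 * geo c.
Proof.
apply/funext => i; rewrite /fps_scale coef_fpsCM /geo exprMn invfM mulrA.
by rewrite (exprS 2) invfM mulrCA mulfV ?mulr1 // expf_neq0 // pnatr_eq0.
Qed.

Lemma hat_sum_odd q K : hat_sum q K.*2.+2 = hat_sum q K.*2.+1.
Proof.
case: q => //= q; rewrite big_nat_recr //= -/(hat_sum q) /= -signr_odd /= odd_double.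
by rewrite expr1 subrr rmorph0 mul0r addr0.
Qed.

(** Hats keep only even indices l = 2i, with weight 2; under X -> 2X the factor 2/(2i - X) becomes
    1/(i - X). *)
Lemma chain_coefE q K : chain_coef R q K = fps_scale 2 (hat_sum q K.*2.+1).
Proof.
elim: K q => [|K IH] q.
  case: q => [|q].
    by apply/funext => -[|i]; rewrite /fps_scale /= ?coef_fps1 ?mulr0 // mul1r.
  by apply/funext => i; rewrite /fps_scale /= big_geq // mulr0.
rewrite [LHS]/= IH; case: q => [|q]; first by rewrite addr0.
rewrite IH -!(hat_sum_odd _ K).
have -> : hat_sum q.+1 K.+1.*2.+1 = hat_sum q.+1 K.*2.+2 +
    fpsC 2 * (geo (2 * K.+1%:R) * hat_sum q K.*2.+2).
  rewrite doubleS [LHS]/= big_nat_recr //=; congr (_ + fpsC _ * (geo _ * _)).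
    by rewrite -signr_odd /= negbK odd_double expr0.
  by rewrite -natrM mul2n.
rewrite fps_scaleD; congr (_ + _).
rewrite !fps_scaleM fps_scale_geo [fps_scale 2 (fpsC 2)](_ : _ = fpsC 2).
  by rewrite !mulrA -rmorphM /= mulfV ?pnatr_eq0 // rmorph1 mul1r.
by apply/funext => -[|i]; rewrite /fps_scale /= ?mulr0 // mul1r.
Qed.

(** Both terms carry the same [hat_sum]. Doubling X costs 2^m in degree m, and 1/(2c - 2X) =
    (1/2)/(c - X) costs one more 2. *)
Lemma paired_hat_sum q j m :
  (geo (j.*2.+1)%:R * hat_sum q j.*2.+1) m
    - (geo (j.*2.+2)%:R * hat_sum q j.*2.+2) m
  = (2 ^+ m.+1)^-1 *
    (chain_coef R q j * (geo (j%:R + 2^-1) - geo j.+1%:R)) m.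
Proof.
have scale f : f m = (2 ^+ m)^-1 * fps_scale 2 f m.
  by rewrite mulKf // expf_neq0 // pnatr_eq0.
rewrite hat_sum_odd -coef_fpsB -mulrBl scale fps_scaleM -chain_coefE.
have -> : fps_scale 2 (geo j.*2.+1%:R - geo j.*2.+2%:R) =
    fpsC 2^-1 * (geo (j%:R + 2^-1) - geo j.+1%:R).
  rewrite fps_scaleB mulrBr -!fps_scale_geo; congr (fps_scale 2 (geo _) - fps_scale 2 (geo _)).
    by rewrite mulrDr mulfV ?pnatr_eq0 // -natrM mul2n natr1.
  by rewrite -natrM mul2n.
by rewrite -mulrA coef_fpsCM exprSr invfM mulrA [chain_coef _ _ _ * _]mulrC.
Qed.

(** Rescaling multiplies by powers of 2, so [chain_coef] dominates [hat_sum]; the factor 1/(j+1)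
    from the outer index beats its growth. *)
Lemma cvg_odd_hat_sum q m :
  (fun j => (geo (j.*2.+1)%:R * hat_sum q j.*2.+1) m) @ \oo --> (0 : R).
Proof.
set r := fun K => K`!%:R / three_quarter_rising R K / K.+1%:R.
pose a : R := \sum_(l < m.+1) 4 ^+ q * 4 ^+ (m - l).
have key j : (geo (j.*2.+1)%:R * hat_sum q j.*2.+1) m <= a * r j.
  rewrite coef_fpsM mulr_suml; apply: ler_sum => l _.
  have h0 := chain_coef_ge0 R q j (m - l).
  have h1 := chain_coef_bound R q j (m - l).
  have le_h : hat_sum q j.*2.+1 (m - l)%N <= chain_coef R q j (m - l)%N.
    rewrite chain_coefE /fps_scale ler_peMl ?exprn_ege1 ?ler1n //.
    by move: h0; rewrite chain_coefE /fps_scale pmulr_rge0 // exprn_gt0.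
  apply: (@le_trans _ _ (j.+1%:R^-1 * chain_coef R q j (m - l)%N)).
    apply: ler_pM => //; first by rewrite geo_ge0.
      by move: h0; rewrite chain_coefE /fps_scale pmulr_rge0 // exprn_gt0.
    rewrite /geo lef_pV2 ?posrE ?exprn_gt0 ?ltr0n //.
    apply: (@le_trans _ _ (j.*2.+1%:R)); first by rewrite ler_nat; lia.
    by rewrite exprS ler_peMr // exprn_ege1 // ler1n.
  apply: (@le_trans _ _ _ _ _ (ler_wpM2l _ h1)); first by rewrite invr_ge0.
  rewrite le_eqVlt; apply/predU1P; left; rewrite /r.
  move: (4 ^+ q : R) (4 ^+ _ : R) (j`!%:R / _ : R) (j.+1%:R^-1 : R) => x y z t.
  ring.
have rc : (fun j => a * r j) @ \oo --> (0 : R).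
  by rewrite -[X in _ --> X](mulr0 a); apply: cvgMl_tmp; apply: fact_over_rising_cvg0.
apply: squeeze_cvgr (cvg_cst 0) rc; near=> j; rewrite key andbT.
rewrite coef_fpsM; apply: sumr_ge0 => l _; rewrite mulr_ge0 ?geo_ge0 //.
have := chain_coef_ge0 R q j (m - l).
by rewrite chain_coefE /fps_scale pmulr_rge0 // exprn_gt0.
Unshelve. all: by end_near.
Qed.

End SumOverCompositions.

(** * Finite families of alternating series *)

Section AlternatingFamily.
Variable R : realType.

Lemma cvg_half : (fun n => n./2) @ \oo --> \oo.
Proof.
apply/cvgnyPge => A; near=> n.
have : (A.*2 <= n)%N by near: n; apply: nbhs_infty_ge.
lia.
Unshelve. all: by end_near.
Qed.

(* Each partial sum up to [2K] is minus a nondecreasing sum of the nonnegative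
   differences [t k (2j+1) - t k (2j+2)], so convergence of the total forces
   convergence of every member of the family. *)
Lemma cvg_alternating_family (I : finType) (P : pred I) (t : I -> nat -> R) l :
  (forall k n, P k -> 0 <= t k n) ->
  (forall k j, P k -> t k j.*2.+2 <= t k j.*2.+1) ->
  (fun K => \sum_(j < K) \sum_(k | P k) (t k j.*2.+1 - t k j.*2.+2)) @ \oo --> l ->
  (fun j => \sum_(k | P k) t k j.*2.+1) @ \oo --> (0 : R) ->
  let S k N := \sum_(1 <= n < N.+1) (-1) ^+ n * t k n in
  (forall k, P k -> cvgn (S k)) /\ \sum_(k | P k) limn (S k) = - l.
Proof.
move=> t0 tdec Dl todd S.
pose D k K := \sum_(j < K) (t k j.*2.+1 - t k j.*2.+2).
have DE : (fun K => \sum_(j < K) \sum_(k | P k) (t k j.*2.+1 - t k j.*2.+2)) =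
    (fun K => \sum_(k | P k) D k K).
  by apply/funext => K; rewrite exchange_big.
rewrite DE in Dl.
have Dnd k : P k -> nondecreasing_seq (D k).
  move=> Pk; apply/nondecreasing_seqP => K.
  by rewrite /D big_ord_recr lerDl subr_ge0 tdec.
have Dcv k : P k -> cvgn (D k).
  move=> Pk; apply: nondecreasing_is_cvgn; first exact: Dnd.
  exists l => _ [K _ <-].
  have tot_nd : nondecreasing_seq (fun K => \sum_(k | P k) D k K).
    by move=> a b ab; apply: ler_sum => i Pi; apply: Dnd.
  rewrite -(cvg_lim _ Dl) //.
  apply: le_trans (nondecreasing_cvgn_le tot_nd _ K); last by apply/cvg_ex; exists l.
  rewrite (bigD1 k) //= lerDl; apply: sumr_ge0 => i /andP[Pi _].
  by apply: sumr_ge0 => j _; rewrite subr_ge0 tdec.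
have todd0 k : P k -> (fun j => t k j.*2.+1) @ \oo --> (0 : R).
  move=> Pk; apply: squeeze_cvgr (cvg_cst 0) todd; near=> j.
  by rewrite t0 //= (bigD1 k) //= lerDl; apply: sumr_ge0 => i /andP[Pi _]; apply: t0.
(* Pairing leaves one unmatched term when [N] is odd, which tends to zero by [todd0]. *)
have SE k : S k = (fun N => - D k N./2 - (odd N)%:R * t k (N./2).*2.+1).
  apply/funext; elim=> [|N IH].
    by rewrite /S /D big_geq // big_ord0 oppr0 mul0r subr0.
  rewrite /S big_nat_recr //= -/(S k N) IH -signr_odd /= uphalf_half.
  have [oN|eN] := boolP (odd N).
    rewrite add1n /D big_ord_recr /= mul0r subr0 expr0 !mul1r.
    have -> : N.+1 = (N./2).*2.+2 by lia.
    ring.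
  rewrite add0n mul0r subr0 expr1 mul1r.
  have -> : N.+1 = (N./2).*2.+1 by lia.
  ring.
have Scv k : P k -> S k @ \oo --> - limn (D k).
  move=> Pk; rewrite SE -[X in _ --> X]subr0; apply: cvgB.
    by apply: cvgN; apply: cvg_comp cvg_half _; apply: Dcv.
  have th : (fun N => t k (N./2).*2.+1) @ \oo --> (0 : R).
    exact: (cvg_comp _ _ cvg_half (todd0 k Pk)).
  apply: squeeze_cvgr (cvg_cst 0) th; near=> N.
  by case: (odd N); rewrite ?mul1r ?mul0r lexx t0.
split=> [k Pk|]; first by apply/cvg_ex; exists (- limn (D k)); apply: Scv.
rewrite (eq_bigr (fun k => - limn (D k))) => [|k Pk]; last first.
  by apply/cvg_lim => //; apply: Scv.
rewrite sumrN; congr (- _); apply/esym.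
apply: (cvg_unique _ Dl) => //.
by apply: cvg_big => [|k Pk]; [exact: add_continuous | apply: Dcv].
Unshelve. all: by end_near.
Qed.

End AlternatingFamily.

(** * Central binomial coefficients and the two identities *)

Lemma half_rising_bin (R : realType) n :
  half_rising R n = n`!%:R * ('C(2 * n, n)%:R / 4 ^+ n).
Proof.
elim: n => [|n IH]; first by rewrite /half_rising big_ord0 bin0 expr0 divr1 mulr1.
have binS : (n.+1 * 'C(2 * n.+1, n.+1) = 2 * (2 * n).+1 * 'C(2 * n, n))%N.
  have -> : (2 * n.+1 = (2 * n).+2)%N by lia.
  rewrite -mul_bin_diag /= -(@bin_sub (2 * n).+1 n); last by lia.
  have -> : ((2 * n).+1 - n = n.+1)%N by lia.
  by have := mul_bin_diag (2 * n).+1 n; rewrite /= => h; nia.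
rewrite half_risingS IH factS (mulnC n.+1 n`!) natrM exprS -!mulrA; congr (_ * _).
rewrite [RHS]mulrA -natrM binS !natrM -[(2 * n).+1%:R]natr1 natrM.
by field; rewrite expf_neq0 // pnatr_eq0.
Qed.

Lemma mmzv_partial_bar (R : realType) a (s : seq (nat * decoration)) N :
  mmzv_partial R ((a, Bar) :: s) N =
  \sum_(1 <= n < N.+1) (-1) ^+ n * (nested R s n / n%:R ^+ a).
Proof.
by rewrite mmzv_partialE /=; apply: eq_bigr => n _; rewrite -mulrA [X in _ * X]mulrC.
Qed.

Lemma nested_hat_odd (R : realType) a (s : seq (nat * decoration)) j :
  nested R ((a, Hat) :: s) j.*2.+2 = nested R ((a, Hat) :: s) j.*2.+1.
Proof.
rewrite /= big_nat_recr //= -[in X in _ + X]signr_odd /= odd_double expr1 subrr.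
by rewrite !mul0r addr0.
Qed.

Lemma nested_hats_ge0 (R : realType) ks n : 0 <= nested R (hats ks) n.
Proof.
elim: ks n => [|k ks IH] n //=; apply: sumr_ge0 => j _.
rewrite mulr_ge0 ?divr_ge0 ?exprn_ge0 // -signr_odd.
by case: (odd j); rewrite ?expr1 ?subrr ?expr0 ?addr_ge0.
Qed.

(** The n! in (1/2)_n = n! C(2n,n)/4^n turns the coefficient of [inv_rising] into the star sum. *)
Lemma zeta_star_binom_sum (R : realType) m q N :
  \sum_(1 <= n < N.+1)
    zeta_star_ones R n m * 'C(2 * n, n)%:R / (4%:R ^+ n * n%:R ^+ q.+1)
  = binom_sum R N q 0 m.
Proof.
rewrite /binom_sum coef_fps_sum; apply: eq_bigr => n _.
rewrite coef_fpsCM zeta_star_onesE half_rising_bin invfM.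
move: (n`!%:R) (inv_rising _ _ _ _) ('C(_, _)%:R) (4 ^+ n)^-1 (n%:R ^+ q.+1)^-1.
by move=> a b c d e; ring.
Qed.

(* Common to both identities: the members [t k] are the summands, up to sign,
   of the alternating series on the right-hand side. *)
Lemma cvg_zeta_star_sum (R : realType) (I : finType) (P : pred I)
    (t : I -> nat -> R) m q :
  (forall k n, P k -> 0 <= t k n) ->
  (forall k j, P k -> t k j.*2.+2 <= t k j.*2.+1) ->
  (forall n, \sum_(k | P k) t k n = (geo n%:R * hat_sum R q n) m) ->
  let S k N := \sum_(1 <= n < N.+1) (-1) ^+ n * t k n in
  (forall k, P k -> cvgn (S k)) /\
  (fun N => binom_sum R N q 0 m) @ \oo
    --> - 2%:R ^+ m.+1 * \sum_(k | P k) limn (S k).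
Proof.
move=> t0 tdec tE S.
have [l [bl cl]] := cvg_binom_sum R q m.
have pairs : (fun K => \sum_(j < K) \sum_(k | P k) (t k j.*2.+1 - t k j.*2.+2))
    @ \oo --> (2 ^+ m.+1)^-1 * l.
  rewrite (_ : (fun K => _) = (fun K => (2 ^+ m.+1)^-1 * \sum_(j < K)
      (chain_coef R q j * (geo (j%:R + 2^-1) - geo j.+1%:R)) m)).
    exact: cvgMl_tmp.
  apply/funext => K; rewrite big_distrr; apply: eq_bigr => j _.
  by rewrite sumrB !tE paired_hat_sum.
have odd0 : (fun j => \sum_(k | P k) t k j.*2.+1) @ \oo --> (0 : R).
  rewrite (funext (fun j => tE j.*2.+1)); exact: cvg_odd_hat_sum.
have [Scv ->] := cvg_alternating_family t0 tdec pairs odd0.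
split=> //; rewrite mulrNN mulVKf // expf_neq0 // pnatr_eq0.
Qed.

Theorem theorem2p4 (R : realType) (m p : nat) :
  let w := (m + p + 2)%N in
  [/\ cvgn (mmzv_partial R [:: (m.+1, Bar)]),
      (fun N : nat => \sum_(1 <= n < N.+1)
         zeta_star_ones R n m * 'C(2 * n, n)%:R / (4%:R ^+ n * n%:R)) @ \oo
        --> - 2%:R ^+ m.+1 * mmzv R [:: (m.+1, Bar)],
      (forall k : p.+1.-tuple 'I_w, admissible k ->
         cvgn (mmzv_partial R (rhs_args k)))
    & (fun N : nat => \sum_(1 <= n < N.+1)
         zeta_star_ones R n m * 'C(2 * n, n)%:R / (4%:R ^+ n * n%:R ^+ p.+2))
        @ \oo
        --> - 2%:R ^+ m.+1 *
            \sum_(k : p.+1.-tuple 'I_w | admissible k) mmzv R (rhs_args k)].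
Proof.
move=> w.
have powV_dec a j : (j.*2.+2%:R ^+ a)^-1 <= (j.*2.+1%:R ^+ a)^-1 :> R.
  by rewrite lef_pV2 ?posrE ?exprn_gt0 ?ltr0n // lerXn2r ?nnegrE // ler_nat.
(* The first identity is the case [q = 0]: a family with one member and no hatted index. *)
have tE1 n : \sum_(k : unit) nested R [::] n / n%:R ^+ m.+1 =
    (geo n%:R * hat_sum R 0 n) m.
  by rewrite (big_pred1 tt) => [|[]//]; rewrite mulr1 mul1r.
have [cv1 lim1] := @cvg_zeta_star_sum R unit xpredT
  (fun _ n => nested R [::] n / n%:R ^+ m.+1) m 0
  (fun _ n _ => divr_ge0 ler01 (exprn_ge0 _ (ler0n _ _)))
  (fun _ j _ => ler_wpM2l ler01 (powV_dec _ _)) tE1.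
have t0 (k : p.+1.-tuple 'I_w) n : admissible k -> 0 <= tail_sum R k n.
  by move=> _; rewrite divr_ge0 ?exprn_ge0 // (nested_hats_ge0 R (_ :: _)).
have tdec (k : p.+1.-tuple 'I_w) j : admissible k ->
    tail_sum R k j.*2.+2 <= tail_sum R k j.*2.+1.
  (* The inner sums agree at 2j+1 and 2j+2, so only the power of the outer index changes. *)
  move=> _; rewrite /tail_sum [behead _]/= nested_hat_odd ler_wpM2l //.
  exact: (nested_hats_ge0 R (_ :: _)).
(* The second identity is the case [q = p.+1], for the family of admissible tuples. *)
have [cv2 lim2] := cvg_zeta_star_sum t0 tdec (@admissible_sum R m p).
have part1 : mmzv_partial R [:: (m.+1, Bar)] =
    (fun N => \sum_(1 <= n < N.+1) (-1) ^+ n * (nested R [::] n / n%:R ^+ m.+1)).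
  by apply/funext => N; apply: mmzv_partial_bar.
have part2 (k : p.+1.-tuple 'I_w) : mmzv_partial R (rhs_args k) =
    (fun N => \sum_(1 <= n < N.+1) (-1) ^+ n * tail_sum R k n).
  by apply/funext => N; apply: mmzv_partial_bar.
split.
- by rewrite part1; apply: (cv1 tt).
- rewrite /mmzv part1; move: lim1; rewrite (big_pred1 tt) => [|[]//].
  by rewrite -(funext (zeta_star_binom_sum R m 0)).
- by move=> k /cv2; rewrite part2.
- rewrite (funext (zeta_star_binom_sum R m p.+1)).
  rewrite (eq_bigr (fun k => limn (fun N => \sum_(1 <= n < N.+1) (-1) ^+ n * tail_sum R k n))).
    exact: lim2.
  by move=> k _; rewrite /mmzv part2.
Qed.
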